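(* Let $A$ be a wqo. If $\mathbf{w}(A)$ is infinite then $\mathbf{w}(\mathcal{P}_f(A))\ge 2^{\mathbf{w}(A)}$. If $\mathbf{w}(A)=k<\omega$ then $\mathbf{w}(\mathcal{P}_f(A))\ge \mathbf{w}(\mathcal{P}_f(\Gamma_k))$.
   Context: A quasi-order $(A,\le)$ is a well-quasi-order (wqo) if every infinite sequence $x_0,x_1,\dots$ in $A$ has indices $i<j$ with $x_i\le x_j$. For a wqo $A$, let $\mathrm{Bad}(A)$, $\mathrm{Dec}(A)$, $\mathrm{Inco}(A)$ be the trees of finite bad sequences (sequences with no $i<j$, $x_i\le x_j$), finite strictly decreasing sequences, and finite sequences of pairwise incomparable elements of $A$, respectively; the root is the empty sequence and the children of a sequence are its one-element extensions. These trees are well-founded; the rank of a node $s$ is $r(s)=\sup\{r(t)+1 : t \text{ a child of } s\}$. The maximal order type $\mathbf{o}(A)$, height $\mathbf{h}(A)$ and width $\mathbf{w}(A)$ are the ranks of the roots of $\mathrm{Bad}(A)$, $\mathrm{Dec}(A)$, $\mathrm{Inco}(A)$ respectively. $\mathcal{P}_f(A)$ denotes the set of finite subsets of $A$ ordered by the Hoare embedding: $S\le_H S'$ iff for every $a\in S$ there is $b\in S'$ with $a\le b$. $\Gamma_k$ denotes a $k$-element antichain (so $\mathcal{P}_f(\Gamma_k)$ is the set of subsets of a $k$-element set ordered by inclusion). *)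

(* Defs.v *)
From mathcomp Require Import all_boot.
From Stdlib Require List.

Set Implicit Arguments.
Unset Strict Implicit.
Unset Printing Implicit Defensive.

(* Ordinals as Brouwer trees.  [OSup I f] denotes sup_{i:I} (f i + 1). *)
Inductive Ord : Type := OSup : forall (Ix : Type), (Ix -> Ord) -> Ord.

Fixpoint ole (x y : Ord) {struct x} : Prop :=
  match x with
  | OSup _ f => forall i,
      match y with OSup _ g => exists j, ole (f i) (g j) end
  end.

Definition olt (x y : Ord) : Prop :=
  match y with OSup _ g => exists j, ole x (g j) end.

Definition oeq (x y : Ord) : Prop := ole x y /\ ole y x.

Definition oidx (x : Ord) : Type := match x return Type with OSup Ix _ => Ix end.
Definition ochild (x : Ord) : oidx x -> Ord :=
  match x return oidx x -> Ord with OSup _ f => f end.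

Definition ozero : Ord := @OSup Empty_set (fun e => match e with end).

Fixpoint onat (n : nat) : Ord :=
  match n with 0 => ozero | S m => @OSup unit (fun _ => onat m) end.

Definition omega : Ord := @OSup nat onat.

(* ordinal addition: x + sup_j (g j + 1) = max (x, sup_j ((x + g j) + 1)) *)
Fixpoint oadd (x y : Ord) {struct y} : Ord :=
  match y with
  | OSup J g => @OSup (oidx x + J)%type
      (fun k => match k with inl i => ochild i | inr j => oadd x (g j) end)
  end.

(* ordinal exponentiation 2^x :
   2^(sup_i (f i + 1)) = max (1, sup_i (2^(f i) + 2^(f i))) *)
Fixpoint opow2 (x : Ord) : Ord :=
  match x with
  | OSup Ix f => @OSup (unit + {i : Ix & oidx (oadd (opow2 (f i)) (opow2 (f i)))})%type
      (fun k => match k with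
                | inl _ => ozero
                | inr (existT i c) => ochild c
                end)
  end.

Inductive rank_is (T : Type) (child : T -> T -> Prop) : T -> Ord -> Prop :=
  | rank_intro (s : T) (f : {t : T | child t s} -> Ord) :
      (forall t, rank_is child (proj1_sig t) (f t)) ->
      rank_is child s (OSup f).

Definition is_qo (A : Type) (le : A -> A -> Prop) : Prop :=
  (forall x, le x x) /\ (forall x y z, le x y -> le y z -> le x z).

Definition is_wqo (A : Type) (le : A -> A -> Prop) : Prop :=
  is_qo le /\ forall f : nat -> A, exists i j, (i < j)%N /\ le (f i) (f j).

Definition incomp (A : Type) (le : A -> A -> Prop) (x y : A) : Prop :=
  ~ le x y /\ ~ le y x.

Fixpoint pairwiseP (A : Type) (R : A -> A -> Prop) (s : seq A) : Prop :=
  match s with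
  | [::] => True
  | x :: s' => (forall y, List.In y s' -> R x y) /\ pairwiseP R s'
  end.

Definition inco_child (A : Type) (le : A -> A -> Prop) (t s : seq A) : Prop :=
  exists x, t = rcons s x /\ pairwiseP (incomp le) t.

Definition width_is (A : Type) (le : A -> A -> Prop) (w : Ord) : Prop :=
  rank_is (inco_child le) [::] w.

Definition Pf (A : Type) : Type :=
  {P : A -> Prop | exists l : seq A, forall x, P x <-> List.In x l}.

Definition hoare (A : Type) (le : A -> A -> Prop) (S T : Pf A) : Prop :=
  forall a, proj1_sig S a -> exists b, proj1_sig T b /\ le a b.

Definition Gamma (k : nat) : Type := 'I_k.
Definition Gamma_le (k : nat) (x y : Gamma k) : Prop := x = y.

(* Main.v *)
(** Call [E] robust for [a] if some [B] inside [E] is such that, for every finite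
    [F] inside [B], the finite subsets of [B] not below [F] have width at least
    [a]. By induction on an infinite ordinal [g], any [E] of width at least [g]
    is robust for [2^g].

    Successor [g + 1]: pick [x] such that [E_x], the set of elements of [E]
    incomparable to [x], has width at least [g], and take [B] inside [E_x]
    robust for [2^g]. Play the sets [S + x] first, then sets [S'] not below all
    that was played: the two rounds add up to [2^g + 2^g].

    Limit [g] = sup [g_i]: shrink [E] so that no [E_x] has width [g], and let [D]
    be a minimal downward closed set that contains, for every [i], some [z] with
    [E_z] of width at least [g_i]. This property passes to one part of any
    finite partition of [D], so the witnesses may avoid the downward closure of
    any finite subset of [B = {b in E | b is not an upper bound of D}]. Any
    element incomparable to a [z] in [D] is in [B]; hence the sets [S + z] with
    [S] inside [E_z] lie in [B], and [z] alone keeps them from being below [F]. *)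

Require Import Defs.
From mathcomp Require Import all_boot.
From Stdlib Require Import Classical ClassicalEpsilon.

Set Implicit Arguments.
Unset Strict Implicit.
Unset Printing Implicit Defensive.

(** * Order and arithmetic of Brouwer-tree ordinals *)

Lemma ole_refl x : ole x x.
Proof. by elim: x => I f IH i; exists i; apply: IH. Qed.

Lemma ole_trans y x z : ole x y -> ole y z -> ole x z.
Proof.
elim: y x z => J g IH [I f] [K h] xy yz i.
have [j fg] := xy i; have [k gh] := yz j.
by exists k; apply: IH fg gh.
Qed.

Lemma olt_ole_trans x y z : olt x y -> ole y z -> olt x z.
Proof.
case: y z => J g [K h] [j xg] yz; have [k gh] := yz j.
by exists k; apply: ole_trans xg gh.
Qed.

Lemma olt_leW x y : olt x y -> ole x y.
Proof.
elim: x y => I f IH [J g] [j xg] i.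
exists j; apply: IH; apply: olt_ole_trans xg.
by exists i; apply: ole_refl.
Qed.

Lemma ole_olt_total x y : ole x y \/ olt y x.
Proof.
elim: x y => I f IH y.
case: (classic (exists i, ole y (f i))) => [yf|nyf]; first by right.
left; case: y nyf => J g nyf i.
case: (IH i (OSup g)) => [le_fg|]; last first.
  by move=> lt_gf; case: nyf; exists i; apply: olt_leW.
case: (classic (exists j, ole (f i) (g j))) => // nfg.
case: nyf; exists i.
(* Unfolded, [ole (OSup g) (f i)] says exactly that every [g j] is strictly below [f i]. *)
suff: forall j, olt (g j) (f i) by case: (f i).
by move=> j; case: (IH i (g j)) => // fg; case: nfg; exists j.
Qed.

Lemma ole_ochildren x y : (forall i : oidx x, olt (ochild i) y) -> ole x y.
Proof. by case: x y => I f [J g]. Qed.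

Lemma olt_ochild x (i : oidx x) : olt (ochild i) x.
Proof. by case: x i => I f i; exists i; apply: ole_refl. Qed.

Lemma oadd_ge_l x y : ole x (oadd x y).
Proof.
case: y => J g; apply: ole_ochildren => i /=.
by exists (inl i); apply: ole_refl.
Qed.

Lemma oadd_mono x x' y y' :
  ole x x' -> ole y y' -> ole (oadd x y) (oadd x' y').
Proof.
move=> xx'; elim: y y' => J g IH [J' g'] yy' [i|j] /=.
  change (olt (ochild i) (oadd x' (OSup g'))).
  apply: olt_ole_trans (olt_ochild i) _; apply: ole_trans xx' _.
  exact: oadd_ge_l.
have [j' gg'] := yy' j.
by exists (inr j'); apply: IH.
Qed.

Lemma opow2_pos x : olt ozero (opow2 x).
Proof. by case: x => I f; exists (inl tt); apply: ole_refl. Qed.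

(** Monotonicity at [a] is a hypothesis so that the lemma can serve inside the induction that proves
    [opow2_mono]; [opow2_step] then discharges it. *)
Lemma opow2_double a b :
  olt a b -> (forall a', ole a a' -> ole (opow2 a) (opow2 a')) ->
  ole (oadd (opow2 a) (opow2 a)) (opow2 b).
Proof.
case: b => J g [j ag] mono_a; apply: ole_trans (_ : ole _ _).
  exact: oadd_mono (mono_a _ ag) (mono_a _ ag).
apply: ole_ochildren => c.
by exists (inr (existT _ j c)); apply: ole_refl.
Qed.

Lemma opow2_mono x y : ole x y -> ole (opow2 x) (opow2 y).
Proof.
elim: x y => I f IH y xy; apply: ole_ochildren => -[[]|[i c]] /=.
  exact: opow2_pos.
apply: olt_ole_trans (olt_ochild c) _.
apply: opow2_double => [|a']; last exact: IH.
by case: y xy => J g; apply.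
Qed.

Lemma opow2_step a b : olt a b -> ole (oadd (opow2 a) (opow2 a)) (opow2 b).
Proof. by move=> ab; apply: opow2_double => // a'; apply: opow2_mono. Qed.

(** A supremum with a greatest child [f i] is the successor of [f i]. *)
Lemma opow2_le_succ I (f : I -> Ord) i :
  (forall j, ole (f j) (f i)) ->
  ole (opow2 (OSup f)) (oadd (opow2 (f i)) (opow2 (f i))).
Proof.
move=> max_i; apply: ole_ochildren => -[[]|[j c]] /=.
  exact: olt_ole_trans (opow2_pos _) (oadd_ge_l _ _).
apply: olt_ole_trans (olt_ochild c) _.
by apply: oadd_mono; apply: opow2_mono.
Qed.

Lemma olt_onatS n : olt (onat n) (onat n.+1).
Proof. by exists tt; apply: ole_refl. Qed.

Lemma oadd_onat a b : ole (oadd (onat a) (onat b)) (onat (b + a)).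
Proof.
elim: b => [|b IH].
  by apply: ole_ochildren => -[i|[]] /=; apply: olt_ochild.
apply: ole_ochildren => -[i|j] /=; last by exists tt.
change (olt (ochild i) (onat (b + a).+1)).
apply: olt_ole_trans (olt_ochild i) _.
by apply: ole_trans (oadd_ge_l _ (onat b)) _; apply: olt_leW; exists tt.
Qed.

Lemma opow2_onat n : exists m, ole (opow2 (onat n)) (onat m).
Proof.
elim: n => [|n [m IH]].
  by exists 1; case=> [[]|[[]]]; exists tt; case.
exists (m + m); apply: ole_trans (oadd_onat m m).
apply: ole_trans (_ : ole _ (oadd (opow2 (onat n)) (opow2 (onat n)))) _.
  by apply: (@opow2_le_succ unit _ tt) => j; apply: ole_refl.
exact: oadd_mono.
Qed.

Lemma omega_le x : (forall n, ole (onat n) x) -> ole omega x.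
Proof.
by move=> le_x; apply: ole_ochildren => n; apply: olt_ole_trans (olt_onatS n) _.
Qed.

Lemma lt_omega x : ~ ole omega x -> exists n, ole x (onat n).
Proof.
move=> nle; apply: NNPP => nex; apply: nle; apply: omega_le => n.
by case: (ole_olt_total x (onat n)) => [?|/olt_leW //]; case: nex; exists n.
Qed.

(** * Width as a game on subsets *)

Lemma In_rcons T (s : seq T) x u :
  List.In u (rcons s x) <-> List.In u s \/ u = x.
Proof.
elim: s => [|v s IHs] /=; last by rewrite IHs; tauto.
by split=> [[->|]|[]] //; [right|move=> ->; left].
Qed.

Section Width.
Variables (T : Type) (le : T -> T -> Prop).
Implicit Types X Y : T -> Prop.

Definition perp X (x : T) : T -> Prop := fun y => X y /\ incomp le x y.

(* [wd X a]: the tree of finite antichains of [X] has rank at least [a]. *)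
Fixpoint wd X (a : Ord) : Prop :=
  match a with OSup _ f => forall i, exists x, X x /\ wd (perp X x) (f i) end.

Lemma wd_sub a X Y : (forall x, X x -> Y x) -> wd X a -> wd Y a.
Proof.
elim: a X Y => I f IH X Y XY wX i; have [x [Xx wx]] := wX i.
exists x; split; first exact: XY.
by apply: IH wx => y [Xy xy]; split; first exact: XY.
Qed.

Lemma wd_ole a b X : ole a b -> wd X b -> wd X a.
Proof.
elim: a b X => I f IH [J g] X ab wX i; have [j fg] := ab i.
have [x [Xx wx]] := wX j.
by exists x; split => //; apply: IH fg wx.
Qed.

Lemma wd_olt a b X : olt a b -> wd X b -> exists x, X x /\ wd (perp X x) a.
Proof.
case: b => J g [j ag] wX; have [x [Xx wx]] := wX j.
by exists x; split => //; apply: wd_ole ag wx.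
Qed.

Lemma wd_lim I (f : I -> Ord) X :
  (forall i, exists j, olt (f i) (f j)) -> (forall i, wd X (f i)) ->
  wd X (OSup f).
Proof. by move=> lim wf i; have [j ij] := lim i; apply: wd_olt ij (wf j). Qed.

Lemma antichain_rcons (R : T -> T -> Prop) s x :
  Defs.pairwiseP R (rcons s x) <->
  Defs.pairwiseP R s /\ forall y, List.In y s -> R y x.
Proof.
elim: s => [|z s IH] /=; first by split=> // _; split.
split=> [[zs /IH[ps sx]]|[[zs ps] sx]].
  split; first by split=> // y ys; apply: zs; apply/In_rcons; left.
  by move=> y [<-|/sx //]; apply: zs; apply/In_rcons; right.
split; last by apply/IH; split=> // y ys; apply: sx; right.
by move=> y /In_rcons[/zs //|->]; apply: sx; left.
Qed.

(** The node [s] of the antichain tree corresponds to the set of elements incomparable to all of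
    [s]; extending [s] by [x] replaces this set by its [perp] at [x]. *)
Lemma rank_ge_wd a s w :
  rank_is (inco_child le) s w -> Defs.pairwiseP (incomp le) s ->
  ole a w <-> wd (fun x => forall y, List.In y s -> incomp le y x) a.
Proof.
elim: a s w => I f IH s _ [{}s g rk_g] ps.
have perpE x y :
    perp (fun x => forall y, List.In y s -> incomp le y x) x y <->
    forall z, List.In z (rcons s x) -> incomp le z y.
  split=> [[sy xy] z /In_rcons[/sy //|-> //]|rsy].
  by split=> [z zs|]; apply: rsy; apply/In_rcons; [left|right].
split=> [le_a i | wa i].
  have [[t ct] fg] := le_a i; move: (rk_g (exist _ t ct)) fg.
  have [x [tE px]] := ct; subst t => rk_t fg; exists x; split.
    by case/antichain_rcons: px.
  exact: wd_sub (fun y => iffRL (perpE x y)) (iffLR (IH i _ _ rk_t px) fg).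
have [x [sx wx]] := wa i.
have px : Defs.pairwiseP (incomp le) (rcons s x) by apply/antichain_rcons.
pose t := exist (fun t => inco_child le t s) (rcons s x)
  (ex_intro _ x (conj erefl px)).
exists t; apply: (iffRL (IH i _ _ (rk_g t) px)).
exact: wd_sub (fun y => iffLR (perpE x y)) wx.
Qed.

Lemma width_ge_wd a w : width_is le w -> ole a w <-> wd (fun=> True) a.
Proof.
move=> rk_w; have -> := @rank_ge_wd a _ _ rk_w I.
by split; apply: wd_sub.
Qed.

Lemma wd_opow2_lim I (f : I -> Ord) (i : I) X :
  (forall i, exists j, olt (f i) (f j)) -> (forall i, wd X (opow2 (f i))) ->
  wd X (opow2 (OSup f)).
Proof.
move=> lim wX [[]|[j c]] /=; first exact: wd_olt (opow2_pos (f i)) (wX i).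
have [k jk] := lim j.
exact: wd_olt (olt_ole_trans (olt_ochild c) (opow2_step jk)) (wX k).
Qed.

Lemma wd_antichain k X : wd X (onat k) ->
  exists g : 'I_k -> T,
    (forall i, X (g i)) /\ forall i j, i <> j -> incomp le (g i) (g j).
Proof.
elim: k X => [|k IH] X wX.
  by exists (fun i : 'I_0 => False_rect T (notF (ltn_ord i))); split => -[].
have [x [Xx /IH[g [gX g_anti]]]] := wX tt.
exists (fun i => if unlift ord0 i is Some j then g j else x); split=> [i|i j].
  by case: unliftP => // j _; case: (gX j).
have incompC y : incomp le x y -> incomp le y x by case.
case: unliftP => [i'|] ->; case: unliftP => [j'|] -> // ij.
- by apply: g_anti => ij'; apply: ij; rewrite ij'.
- by apply: incompC; case: (gX i').
- by case: (gX j').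
Qed.
End Width.

(** A map that reflects the order preserves incomparability, hence carries antichains to
    antichains. *)
Lemma wd_map T U (leT : T -> T -> Prop) (leU : U -> U -> Prop) (h : T -> U)
    (X : T -> Prop) (Y : U -> Prop) a :
  (forall x, X x -> Y (h x)) ->
  (forall x y, X x -> X y -> leU (h x) (h y) -> leT x y) ->
  wd leT X a -> wd leU Y a.
Proof.
elim: a X Y => I f IH X Y XY h_refl wX i; have [x [Xx wx]] := wX i.
exists (h x); split; first exact: XY.
apply: IH wx => [y [Xy [nxy nyx]]|y z [Xy _] [Xz _]]; last exact: h_refl.
by split; [exact: XY | split=> /h_refl]; auto.
Qed.

(** * Finite sets and robustness *)

Section FiniteSets.
Variables (A : Type) (le : A -> A -> Prop).
Implicit Types (B E : A -> Prop) (F S : seq A).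

Definition hle S S' :=
  forall a, List.In a S -> exists b, List.In b S' /\ le a b.

Definition fin_sub B S := forall a, List.In a S -> B a.

Definition escaping B F S := fin_sub B S /\ ~ hle S F.

Definition robust E (a : Ord) := exists B, (forall b, B b -> E b) /\
  forall F, fin_sub B F -> wd hle (escaping B F) a.

Lemma hle_cons x S S' :
  (forall a, List.In a S -> ~ le a x) -> hle (x :: S) (x :: S') -> hle S S'.
Proof.
move=> Sx SS' a aS; have [b [/= [xb|bS'] ab]] := SS' a (or_intror aS).
  by case: (Sx a aS); rewrite xb.
by exists b.
Qed.

Lemma seq_restrict B F :
  exists F', forall a, List.In a F' <-> List.In a F /\ B a.
Proof.
elim: F => [|x F [F' F'E]]; first by exists [::] => a /=; tauto.
case: (classic (B x)) => Bx; last first.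
  exists F' => a; rewrite F'E /=; split=> [|[[<-|]]]; tauto.
exists (x :: F') => a /=; rewrite F'E; split; last tauto.
by case=> [<-|]; tauto.
Qed.

(* The sets [x :: S] with [S] in [Z] come first; once they are used up, sets
   inside [B] that escape everything played so far are still available. *)
Lemma wd_oadd_escaping B x a b (Y Z : seq A -> Prop) F :
  (forall F, fin_sub B F -> wd hle (escaping B F) a) ->
  (forall y, B y -> incomp le x y) ->
  fin_sub B F -> (forall S, escaping B F S -> Y S) ->
  (forall S, Z S -> fin_sub B S /\ Y (x :: S)) ->
  wd hle Z b -> wd hle Y (oadd a b).
Proof.
move=> wB xB; elim: b Y Z F => J g IH Y Z F FB FY ZY wZ [i|j] /=.
  (* A child of [a] is chosen: the first round ends, and play goes on with the sets escaping [F]. *)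
  exact: wd_olt (olt_ochild i) (wd_sub FY (wB F FB)).
have [S [ZS wS]] := wZ j; have [SB YS] := ZY S ZS.
exists (x :: S); split=> //.
(* Adding [S] to [F] suffices to record the move [x :: S]: a set inside [B] and not below [S] is
   incomparable to [x :: S], because [x] is incomparable to [B]. *)
apply: (IH j _ _ (List.app F S)) wS => [c /List.in_app_iff[/FB|/SB]//|S' [S'B S'F]|S'].
  split; first by apply: FY; split=> // S'F'; apply: S'F => c /S'F'[d [dF cd]];
    exists d; split=> //; apply/List.in_app_iff; left.
  split=> [/(_ x (or_introl erefl))[c [/S'B /xB[]]] //|S'xS].
  apply: S'F => c cS'; have [d [/= [xd|dS] cd]] := S'xS c cS'.
    by case: (xB c (S'B c cS')) => _; rewrite xd.
  by exists d; split=> //; apply/List.in_app_iff; right.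
move=> [/ZY[S'B YS'] [SS' S'S]]; split=> //; split=> //.
by split=> /hle_cons h; [apply: SS'|apply: S'S]; apply: h => c;
  [move/SB|move/S'B] => /xB[].
Qed.

Lemma robust_succ E x a : E x ->
  robust (perp le E x) a -> robust E (oadd a a).
Proof.
move=> Ex [B [BE wB]]; exists (fun y => B y \/ y = x); split.
  by move=> b [/BE[]|->].
have xB y : B y -> incomp le x y by case/BE.
(* [F] may contain [x], but no element of [B] is below [x], so only the part of [F] in [B]
   matters. *)
move=> F FBx; have [F' F'E] := seq_restrict B F.
have F'B : fin_sub B F' by move=> a' /F'E[].
have F'F S : escaping B F' S -> ~ hle S F.
  move=> [SB SF'] SF; apply: SF' => c cS; have [d [dF cd]] := SF c cS.
  exists d; split=> //; apply/F'E; split=> //.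
  by case: (FBx d dF) cd => // -> cx; case: (xB c (SB c cS)) => _ [].
apply: (wd_oadd_escaping wB xB F'B) (wB F' F'B) => [S SF'|S SF'].
  by split; [move=> c cS; left; apply: SF'.1 | apply: F'F].
split; first exact: SF'.1.
split=> [c /= [<-|/SF'.1]|xSF]; [by right|by left|].
by apply: (F'F S SF') => c cS; apply: xSF; right.
Qed.

Hypothesis le_wqo : is_wqo le.

Let le_tr y x z : le x y -> le y z -> le x z.
Proof. by case: le_wqo => -[_ tr] _; apply: tr. Qed.

(** Each step discards everything above the chosen [x], so the choices along an infinite descent
    would form an infinite bad sequence. *)
Lemma wqo_no_descent (P : (A -> Prop) -> Prop) :
  (forall X, P X -> exists x Y,
     [/\ P Y, X x & forall y, Y y -> X y /\ ~ le x y]) ->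
  forall X, ~ P X.
Proof.
move=> descent X0 PX0.
pose good (s : {X | P X}) (q : A * {X | P X}) :=
  sval s q.1 /\ forall y, sval q.2 y -> sval s y /\ ~ le q.1 y.
have next_ex s : {q | good s q}.
  apply: constructive_indefinite_description; case: s => X PX.
  by have [x [Y [PY Xx XY]]] := descent X PX; exists (x, exist _ Y PY).
pose st n := iter n (fun s => (sval (next_ex s)).2) (exist _ X0 PX0).
pose pick n := (sval (next_ex (st n))).1.
have st_good n : good (st n) (pick n, st n.+1).
  by rewrite /good /pick /=; case: (next_ex (st n)) => -[].
have st_sub n k y : sval (st (k + n)) y -> sval (st n) y.
  elim: k => [//|k IH]; rewrite addSn => /(st_good _).2[+ _]; exact: IH.
have [i [j [ij]]] := le_wqo.2 pick.
have st_j : sval (st (j - i.+1 + i.+1)) (pick j).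
  by rewrite subnK //; exact: (st_good j).1.
by case: ((st_good i).2 (pick j) (st_sub _ _ _ st_j)).
Qed.

Lemma wd_minimal E d : wd le E d ->
  exists E', [/\ forall x, E' x -> E x, wd le E' d &
                 forall x, E' x -> ~ wd le (perp le E' x) d].
Proof.
move=> wE; apply: NNPP => nmin.
pose P X := (forall x, X x -> E x) /\ wd le X d.
apply: (@wqo_no_descent P _ E) => // X [XE wX]; apply: NNPP => nX.
apply: nmin; exists X; split=> // x Xx wx; apply: nX.
exists x, (perp le X x); split=> //; last by move=> y [? []].
by split=> // y [/XE].
Qed.

Definition downclosed (D : A -> Prop) := forall x y, le x y -> D y -> D x.

(** * The limit case *)

Section Limit.
Variables (I : Type) (f : I -> Ord) (E : A -> Prop).
Hypothesis lim : forall i, exists j, olt (f i) (f j).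

Definition covers (D : A -> Prop) :=
  forall i, exists z, [/\ D z, E z & wd le (perp le E z) (f i)].

(** If [Q] fails at [f i] and [R] at [f j], a witness for the larger of the two ordinals lies in
    neither. *)
Lemma covers_or (P Q R : A -> Prop) :
  covers P -> (forall z, P z -> E z -> Q z \/ R z) -> covers Q \/ covers R.
Proof.
move=> cP PQR; apply: NNPP => /not_or_and[].
move=> /not_all_ex_not[i nQ] /not_all_ex_not[j nR].
have [k [ik jk]] : exists k, ole (f i) (f k) /\ ole (f j) (f k).
  case: (ole_olt_total (f i) (f j)) => [ij|/olt_leW ji].
    by exists j; split=> //; apply: ole_refl.
  by exists i; split=> //; apply: ole_refl.
have [z [Pz Ez wz]] := cP k.
case: (PQR z Pz Ez) => [Qz|Rz]; [apply: nQ|apply: nR]; exists z; split=> //.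
  exact: wd_ole ik wz.
exact: wd_ole jk wz.
Qed.

(** A downward closed set that omits [x] omits everything above [x], so shrinking such sets is a
    descent as in [wqo_no_descent]. *)
Lemma covers_minimal : wd le E (OSup f) ->
  exists D, [/\ downclosed D, covers D &
    forall D', downclosed D' -> (forall x, D' x -> D x) -> covers D' ->
      forall x, D x -> D' x].
Proof.
move=> wE; apply: NNPP => nmin.
pose P X := downclosed X /\ covers X.
apply: (@wqo_no_descent P _ (fun=> True)); last first.
  by split=> // i; have [z [Ez wz]] := wE i; exists z.
move=> X [dX cX]; apply: NNPP => nX; apply: nmin; exists X; split=> //.
move=> D' dD' D'X cD' x Xx; apply: NNPP => nD'x; apply: nX.
exists x, D'; split=> // y D'y; split; first exact: D'X.
by move=> xy; apply: nD'x; apply: dD' xy D'y.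
Qed.

Hypothesis wE : wd le E (OSup f).
Hypothesis minE : forall x, E x -> ~ wd le (perp le E x) (OSup f).

Lemma limit_guards : exists B, (forall b, B b -> E b) /\
  forall F, fin_sub B F -> forall i, exists z,
    [/\ B z, forall a, List.In a F -> ~ le z a,
        forall y, perp le E z y -> B y & wd le (perp le E z) (f i)].
Proof.
have [D [dD cD minD]] := covers_minimal wE.
pose B b := E b /\ exists d, D d /\ ~ le d b.
exists B; split=> [b []//|F FB i].
have cB : covers (fun z => D z /\ B z).
  pose top z := D z /\ forall d, D d -> le d z.
  have [//|cR] : covers (fun z => D z /\ B z) \/ covers top.
    apply: covers_or cD _ => z Dz Ez.
    case: (classic (B z)) => [|nB]; [by left|right; split=> // d Dd].
    by apply: NNPP => ndz; apply: nB; split=> //; exists d.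
  have [z [[Dz topz] Ez _]] := cR i.
  (* Elements of [top] are pairwise equivalent, so [z] shares its incomparable elements with the
     witness [y] for each [f j], against [minE]. *)
  case: (minE Ez); apply: wd_lim lim _ => j.
  have [y [[Dy topy] Ey wy]] := cR j.
  apply: wd_sub wy => u [Eu [nyu nuy]]; split=> //; split.
    by move=> zu; apply: nyu; apply: le_tr zu; apply: topz.
  by move=> uz; apply: nuy; apply: le_tr uz _; apply: topy.
have cF : covers (fun z => (D z /\ B z) /\ forall a, List.In a F -> ~ le z a).
  elim: F FB => [_|a F IH FB].
    by move=> j; have [z [? ? ?]] := cB j; exists z.
  have {}IH := IH (fun b bF => FB b (or_intror bF)).
  have [//|cR] :
      covers (fun z => (D z /\ B z) /\ forall b, List.In b (a :: F) -> ~ le z b)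
      \/ covers (fun z => D z /\ le z a).
    apply: covers_or IH _ => z [DBz zF] Ez.
    case: (classic (le z a)) => za; [by right; case: DBz|left; split=> // b].
    by case=> [<-|/zF].
  (* The part of [D] below [a] is downward closed; if it covers, minimality makes it all of [D], and
     [a] bounds [D] although [a] is in [B]. *)
  have [_ [d [Dd nda]]] := FB a (or_introl erefl).
  case: nda; suff [] : D d /\ le d a by [].
  apply: (minD _ _ _ cR) => // [x y xy [Dy ya]|x []//].
  by split; [apply: dD xy Dy|apply: le_tr ya].
have [z [[[Dz Bz] zF] Ez wz]] := cF i; exists z; split=> // y [Ey [nzy _]].
by split=> //; exists z.
Qed.
End Limit.

Lemma wd_singletons E a : wd le E a -> wd hle (fin_sub E) a.
Proof.
apply: (wd_map (h := fun x => [:: x])) => [x Ex y [<-|]//|x y _ _ xy].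
by have [z [[<-|]]] := xy x (or_introl erefl).
Qed.

Lemma wd_robust E a : robust E a -> wd hle (fin_sub E) a.
Proof.
move=> [B [BE wB]]; apply: wd_sub (wB [::] _) => // S [SB _] x /SB.
exact: BE.
Qed.

Lemma robust_opow2 g E : ole omega g -> wd le E g -> robust E (opow2 g).
Proof.
elim: g E => I f IH E inf wE.
(* A greatest child means successor; otherwise [OSup f] is a limit. *)
case: (classic (exists i, forall j, ole (f j) (f i))) => [[i max_i]|nmax].
  have inf_i : ole omega (f i).
    by apply: omega_le => n; have [j nj] := inf n; apply: ole_trans nj _.
  have [x [Ex wx]] := wE i.
  have [B [BE wB]] := robust_succ Ex (IH i _ inf_i wx).
  by exists B; split=> // F /wB; apply: wd_ole; apply: opow2_le_succ.
have lim i : exists j, olt (f i) (f j).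
  apply: NNPP => nj; apply: nmax; exists i => j.
  by case: (ole_olt_total (f j) (f i)) => // ij; case: nj; exists j.
have [E' [E'E wE' minE']] := wd_minimal wE.
have [B [BE' guard]] := limit_guards lim wE' minE'.
exists B; split=> [b /BE'/E'E //|F FB].
have [i0 _] := inf 0; apply: (wd_opow2_lim i0 lim) => i.
have [z [Bz zF zB wz]] : exists z, [/\ B z, forall a, List.In a F -> ~ le z a,
    forall y, perp le E' z y -> B y &
    wd hle (fin_sub (perp le E' z)) (opow2 (f i))].
  (* The induction hypothesis needs [f i] infinite. For finite [f i] the power is finite too, hence
     below some [f j], and singletons are enough. *)
  case: (classic (ole omega (f i))) => [inf_i|/lt_omega[n le_n]].
    have [z [Bz zF zB wz]] := guard F FB i; exists z; split=> //.
    exact: wd_robust (IH i _ inf_i wz).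
  have [m le_m] := opow2_onat n; have [j mj] := inf m.
  have [z [Bz zF zB wz]] := guard F FB j; exists z; split=> //.
  apply: wd_singletons; apply: wd_ole wz; apply: ole_trans mj.
  exact: ole_trans (opow2_mono le_n) le_m.
(* Prefixing [z] makes each set escape [F], and reflects the order since the elements of [S] are
   incomparable to [z]. *)
apply: (wd_map (h := cons z)) wz => [S SE'|S S' SE' _].
  split=> [a /= [<-//|/SE'/zB//]|zSF].
  by have [a [/zF]] := zSF z (or_introl erefl).
by apply: hle_cons => a /SE'[_ []].
Qed.
End FiniteSets.

(** * Transfer to [Pf] and conclusion *)

Definition Pf_of_seq A (S : seq A) : Pf A :=
  exist _ (fun x => List.In x S) (ex_intro _ S (fun x => iff_refl _)).

Lemma Pf_image_finite A B (g : A -> B) (S : Pf A) :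
  exists l, forall b, (exists a, proj1_sig S a /\ g a = b) <-> List.In b l.
Proof.
case: S => P [l Pl] /=; exists (List.map g l) => b; rewrite List.in_map_iff.
by split=> -[a []]; exists a; split=> //; apply/Pl.
Qed.

Definition Pf_image A B (g : A -> B) (S : Pf A) : Pf B :=
  exist _ (fun b => exists a, proj1_sig S a /\ g a = b) (Pf_image_finite g S).

Theorem mainTheorem3 (A : Type) (le : A -> A -> Prop) (HA : is_wqo le) :
  (forall w wP : Ord,
      width_is le w -> width_is (hoare le) wP ->
      ole omega w -> ole (opow2 w) wP) /\
  (forall (k : nat) (w wP wG : Ord),
      width_is le w -> width_is (hoare le) wP ->
      width_is (hoare (@Gamma_le k)) wG ->
      oeq w (onat k) -> ole wG wP).
Proof.
split=> [w wP rk_w rk_P inf|k w wP wG rk_w rk_P rk_G [_ le_kw]].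
  apply/(width_ge_wd _ rk_P).
  have wA := iffLR (width_ge_wd w rk_w) (ole_refl w).
  by apply: (wd_map (h := @Pf_of_seq A)) (wd_robust (robust_opow2 HA inf wA)).
(* Width [k] yields an antichain of [k] elements; taking images under its enumeration [g] reflects
   the Hoare order. *)
have [g [_ g_anti]] := wd_antichain (iffLR (width_ge_wd _ rk_w) le_kw).
apply/(width_ge_wd _ rk_P).
apply: (wd_map (h := Pf_image g)) (iffLR (width_ge_wd _ rk_G) (ole_refl wG)) => //.
move=> S S' _ _ SS' i Si.
have [_ [[j [S'j <-]] le_ij]] := SS' (g i) (ex_intro _ i (conj Si erefl)).
exists j; split=> //; apply: NNPP => /g_anti[nle_ij _]; exact: nle_ij.
Qed.
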